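(* Assume that $\operatorname{cov}(\mathcal{M})=\mathfrak{c}$. Then there exists a subgroup of $\mathbb{Z}^{\mathbb{N}}$ which is Rothberger-bounded (and Scheepers-bounded) but not Hurewicz-bounded.
   Context: $\mathfrak{c}=2^{\aleph_0}$, and $\operatorname{cov}(\mathcal{M})$ is the minimal cardinality of a cover of $\mathbb{R}$ by meager sets; equivalently, the minimal cardinality of $Y\subseteq\mathbb{N}^{\mathbb{N}}$ such that there is no $f\in\mathbb{N}^{\mathbb{N}}$ with the property that for each $y\in Y$, $f(n)=y(n)$ for some $n$. The group $\mathbb{Z}^{\mathbb{N}}$ carries pointwise addition and the product topology ($\mathbb{Z}$ discrete); subgroups carry the subspace topology. For a topological group $(G,\cdot)$, with the condition required for each sequence $(U_n)_{n\in\mathbb{N}}$ of neighborhoods of the unit: $G$ is Rothberger-bounded if there exist $a_n\in G$ such that $G=\bigcup_n a_n\cdot U_n$; Scheepers-bounded if there exist finite $F_n\subseteq G$ such that for each finite $F\subseteq G$ there is $n$ with $F\subseteq F_n\cdot U_n$; Hurewicz-bounded if there exist finite $F_n\subseteq G$ such that each $g\in G$ belongs to $F_n\cdot U_n$ for all but finitely many $n$. Here $A\cdot B=\{a\cdot b:a\in A,\ b\in B\}$ and $a\cdot B=\{a\cdot b:b\in B\}$. *)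

(* Defs.v *)
From HB Require Import structures.
From mathcomp Require Import all_boot all_order all_algebra.
From mathcomp Require Import all_classical all_reals all_analysis.

Set Implicit Arguments.
Unset Strict Implicit.
Unset Printing Implicit Defensive.

Import Order.TTheory GRing.Theory Num.Theory.
Import numFieldNormedType.Exports.

Local Open Scope classical_set_scope.
Local Open Scope card_scope.
Local Open Scope ring_scope.

Definition nowhere_dense (T : topologicalType) (A : set T) : Prop :=
  interior (closure A) = set0.

Definition meager (T : topologicalType) (A : set T) : Prop :=
  exists2 F : (set T)^nat,
    (forall n, nowhere_dense (F n)) & A `<=` \bigcup_n F n.

Definition meager_cover (T : topologicalType) (C : set (set T)) : Prop :=
  (forall A, C A -> meager A) /\ \bigcup_(A in C) A = [set: T].

(* Cardinals are represented by arbitrary sets of that cardinality. *)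
Definition cov_meager_is (T : topologicalType) (U : Type) (K : set U) : Prop :=
  (exists2 C : set (set T), meager_cover C & C #= K) /\
  (forall C : set (set T), meager_cover C -> K #<= C).

Definition cov_meager_eq_continuum (R : realType) : Prop :=
  @cov_meager_is R (nat -> bool) [set: nat -> bool].

(* Written additively: the groups of interest, the subgroups of Z^N, are
   abelian.  A neighborhood of 0 need not be open. *)
Section bounded_groups.
Variable G : topologicalZmodType.
Implicit Types (U : (set G)^nat) (A : (set G)^nat).

Definition rothberger_bounded : Prop :=
  forall U, (forall n, nbhs (0 : G) (U n)) ->
  exists a : G^nat, [set: G] = \bigcup_n [set a n + u | u in U n].

Definition scheepers_bounded : Prop :=
  forall U, (forall n, nbhs (0 : G) (U n)) ->
  exists2 A, (forall n, finite_set (A n)) &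
    forall B : set G, finite_set B ->
      exists n, B `<=` [set a + u | a in A n & u in U n].

Definition hurewicz_bounded : Prop :=
  forall U, (forall n, nbhs (0 : G) (U n)) ->
  exists2 A, (forall n, finite_set (A n)) &
    forall g : G, \forall n \near \oo,
      [set a + u | a in A n & u in U n] g.

End bounded_groups.

Definition subgroup_type (V : topologicalZmodType) (G : zmodClosed V) : Type :=
  {x : V | x \in G}.

Section subgroup_topology.
Variables (V : topologicalZmodType) (G : zmodClosed V).
Local Notation S := (subgroup_type G).

Definition subgroup_val (x : S) : V := sval x.

HB.instance Definition _ := SubChoice.copy S {x : V | x \in G}.
HB.instance Definition _ := [SubChoice_isSubZmodule of S by <:].
HB.instance Definition _ :=
  Topological.copy S (initial_topology subgroup_val).

Let subgroup_sub_continuous : continuous (fun x : S * S => x.1 - x.2).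
Proof.
have cv : continuous (subgroup_val : S -> V) by exact: initial_continuous.
apply: continuous_comp_initial => x.
apply: (@continuous_comp _ _ _
  (fun x : S * S => (subgroup_val x.1, subgroup_val x.2))
  (fun x : V * V => x.1 - x.2)); last exact: sub_continuous.
by apply: cvg_pair; apply: continuous_comp;
  [exact: cvg_fst|exact: cv|exact: cvg_snd|exact: cv].
Qed.

HB.instance Definition _ :=
  PreTopologicalNmodule_isTopologicalZmodule.Build S subgroup_sub_continuous.

End subgroup_topology.

Definition Zdiscrete : Type := discrete_topology int.
HB.instance Definition _ := DiscreteTopology.copy Zdiscrete (discrete_topology int).
HB.instance Definition _ := GRing.Zmodule.copy Zdiscrete int.

Definition ZN : Type := {ptws nat -> Zdiscrete}.
HB.instance Definition _ := Topological.copy ZN {ptws nat -> Zdiscrete}.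
HB.instance Definition _ := GRing.Zmodule.copy ZN (nat -> int).

Section ZN_topological_group.

Let ZN_continuous (T : topologicalType) (f : T -> ZN) :
  (forall i, continuous (fun x => f x i)) -> continuous f.
Proof.
move=> cf x; apply/(@cvg_sup (forall _ : nat, Zdiscrete) nat (fun i =>
  Topological.class (initial_topology (fun f : nat -> Zdiscrete => f i)))
  (f @ x)) => i.
exact: (@continuous_comp_initial (nat -> Zdiscrete) T Zdiscrete
  (fun f => f i) f (cf i) x).
Qed.

Let ZN_sub_continuous : continuous (fun x : ZN * ZN => x.1 - x.2).
Proof.
have near_eq i (f : ZN) : nbhs f [set g : ZN | g i = f i].
  have ci : {for f, continuous (fun g : ZN => g i)}.
    exact: (@proj_continuous nat (fun=> Zdiscrete) i f).
  by apply: (ci [set f i]); exact: discrete_set1.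
have cc i : continuous (fun x : ZN * ZN => (x.1 - x.2) i : Zdiscrete).
  move=> x U /nbhs_singleton Ux.
  exists ([set g : ZN | g i = x.1 i], [set g : ZN | g i = x.2 i]).
    by split; exact: near_eq.
  move=> [y z] [/= yi zi]; move: Ux.
  have -> : (x.1 - x.2) i = (x.1 i : int) - (x.2 i : int) by [].
  have -> : (y - z) i = (y i : int) - (z i : int) by [].
  by rewrite yi zi.
exact: ZN_continuous cc.
Qed.

HB.instance Definition _ :=
  PreTopologicalNmodule_isTopologicalZmodule.Build ZN ZN_sub_continuous.

End ZN_topological_group.

(* Main.v *)
From HB Require Import structures.
Require Import Defs.
From mathcomp Require Import all_boot all_order all_algebra.
From mathcomp Require Import all_classical all_reals all_analysis.
From mathcomp Require Import wochoice zify ring lra.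

(* The group is generated by Cohen-generic sequences x_a : nat -> int, indexed
   by a well-order whose proper initial segments have fewer than c elements.
   Under cov(M) = c each x_a can be taken generic for the fewer than c dense
   sets arising from its predecessors, by means of the poset of pairs (finite
   sequence, promise that all later values are divisible by a given integer).
   The promises are what make k * x + g, for g in the group generated before
   x, agree with a finitely supported sequence on a prescribed initial
   segment: one sets x = - g / k far out. Group elements whose leading index
   precedes the bookkeeping stage are fewer than c many, and for these a
   further generic sequence does the work. *)

Set Implicit Arguments.
Unset Strict Implicit.
Unset Printing Implicit Defensive.

Import Order.TTheory GRing.Theory Num.Theory.
Import numFieldNormedType.Exports.

Local Open Scope classical_set_scope.
Local Open Scope card_scope.

(** * Infinite cardinals *)

Definition injects (A B : Type) := exists f : A -> B, injective f.

Lemma injects_trans (A B C : Type) : injects A B -> injects B C -> injects A C.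
Proof. by move=> [f fi] [g gi]; exists (g \o f); exact: inj_comp. Qed.

Lemma injects_prod (A B C D : Type) :
  injects A C -> injects B D -> injects (A * B) (C * D).
Proof.
move=> [f fi] [g gi]; exists (fun x => (f x.1, g x.2)).
by move=> [a b] [a' b'] /= [/fi -> /gi ->].
Qed.

Lemma injects_sum (A B C : Type) :
  injects nat C -> injects (C * C) C -> injects A C -> injects B C ->
  injects (A + B) C.
Proof.
move=> [n ni] [p pi] [f fi] [g gi].
exists (fun x => match x with inl a => p (n 0, f a) | inr b => p (n 1, g b) end).
move=> [a|b] [a'|b'] /pi [].
- by move=> /fi ->.
- by move=> /ni.
- by move=> /ni.
- by move=> /gi ->.
Qed.

Lemma injects_seq (A C : Type) :
  injects nat C -> injects (C * C) C -> injects A C -> injects (seq A) C.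
Proof.
move=> [n ni] [p pi] [f fi].
(* The length is coded as well, so that the code of the empty list cannot be confused with that of a
   pair. *)
exists (fun s => p (n (size s), foldr (fun a c => p (f a, c)) (n 0) s)).
move=> s t /pi [/ni]; elim: s t => [|a s IH] [|b t] //= [st].
by move=> /pi [/fi -> /(IH _ st) ->].
Qed.

Definition inj_on T (A B : set T) :=
  exists f : T -> T, (forall x, A x -> B (f x)) /\
    (forall x y, A x -> A y -> f x = f y -> x = y).

(* Zorn's lemma on the graphs of partial injections from A to B. *)
Lemma inj_on_total T (A B : set T) : inj_on A B \/ inj_on B A.
Proof.
pose P (S : set (T * T)) := [/\ forall a b, S (a, b) -> A a /\ B b,
  forall a b b', S (a, b) -> S (a, b') -> b = b' &
  forall a a' b, S (a, b) -> S (a', b) -> a = a'].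
have [|S [[SAB Sf Si] Smax]] := @Zorn_bigcup _ P.
  move=> F FP Ftot; split.
  - by move=> a b [X FX Xab]; have [h _ _] := FP _ FX; exact: h Xab.
  - move=> a b b' [X FX Xab] [Y FY Yab].
    have [XY|YX] := Ftot _ _ FX FY.
      by have [_ h _] := FP _ FY; apply: h Yab; exact: XY.
    by have [_ h _] := FP _ FX; apply: (h _ _ _ Xab); exact: YX.
  - move=> a a' b [X FX Xab] [Y FY Yab].
    have [XY|YX] := Ftot _ _ FX FY.
      by have [_ _ h] := FP _ FY; apply: h Yab; exact: XY.
    by have [_ _ h] := FP _ FX; apply: (h _ _ _ Xab); exact: YX.
have [dA|/existsNP[a0 /not_implyP[Aa0 na0]]] :=
  pselect (forall a, A a -> exists b, S (a, b)).
  left; have /choice[f fS] : forall a, exists b, A a -> S (a, b).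
    by move=> a; have [/dA[b]|nA] := pselect (A a); [exists b|exists a].
  exists f; split; first by move=> x /fS /SAB[].
  by move=> x y /fS Sx /fS Sy e; apply: Si Sx _; rewrite e.
have [dB|/existsNP[b0 /not_implyP[Bb0 nb0]]] :=
  pselect (forall b, B b -> exists a, S (a, b)).
  right; have /choice[f fS] : forall b, exists a, B b -> S (a, b).
    by move=> b; have [/dB[a]|nB] := pselect (B b); [exists a|exists b].
  exists f; split; first by move=> x /fS /SAB[].
  by move=> x y /fS Sx /fS Sy e; apply: Sf Sx _; rewrite e.
exfalso; apply: (Smax (S `|` [set (a0, b0)])).
  split; first by move=> x; left.
  by move=> /(_ (a0, b0)) h; apply: na0; exists b0; apply: h; right.
split.
- by move=> a b [/SAB//|[-> ->]].
- move=> a b b' [Sab|[ea eb]] [Sab'|[ea' eb']].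
  + exact: Sf Sab Sab'.
  + by exfalso; apply: na0; exists b; rewrite -ea'.
  + by exfalso; apply: na0; exists b'; rewrite -ea.
  + by rewrite eb eb'.
- move=> a a' b [Sab|[ea eb]] [Sab'|[ea' eb']].
  + exact: Si Sab Sab'.
  + by exfalso; apply: nb0; exists a; rewrite -eb'.
  + by exfalso; apply: nb0; exists a'; rewrite -eb.
  + by rewrite ea ea'.
Qed.

(* Zorn's lemma on the graphs of injections B * B -> B with B a subset of T
   containing a fixed countable set; a maximal B has a complement that injects
   into B, for otherwise B could be extended by a copy of itself. *)
Lemma injects_square (T : Type) : injects nat T -> injects (T * T) T.
Proof.
move=> [i0 i0i].
pose dom (S : set (T * T * T)) := [set a | exists c, S (a, a, c)].
pose P S := [/\ forall a b c, S (a, b, c) -> [/\ dom S a, dom S b & dom S c],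
  forall a b, dom S a -> dom S b -> exists c, S (a, b, c),
  forall a b c c', S (a, b, c) -> S (a, b, c') -> c = c' &
  forall a b a' b' c, S (a, b, c) -> S (a', b', c) -> (a, b) = (a', b')].
pose S0 : set (T * T * T) :=
  [set (i0 x.1, i0 x.2, i0 (pickle x)) | x in [set: nat * nat]].
have domS0 n : dom S0 (i0 n) by exists (i0 (pickle (n, n))), (n, n).
have PS0 : P S0.
  split.
  - by move=> _ _ _ [[m n] _ [<- <- <-]]; split; exact: domS0.
  - move=> a b [c [[m m'] _ [<- _ _]]] [c' [[n n'] _ [<- _ _]]].
    by exists (i0 (pickle (m, n))), (m, n).
  - move=> _ _ _ c' [[m n] _ [<- <- <-]] [[m' n'] _ [/i0i em /i0i en]] <-.
    by rewrite /= in em en; rewrite em en.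
  - move=> _ _ a b _ [[m n] _ [<- <- <-]].
    by move=> [[m' n'] _ [<- <- /i0i /(pcan_inj pickleK) [-> ->]]].
have Pchain (F : set (set (T * T * T))) :
    F `<=` P -> total_on F subset -> P (\bigcup_(X in F) X).
  move=> FP Ftot.
  have common X Y : F X -> F Y -> exists Z, [/\ F Z, X `<=` Z & Y `<=` Z].
    move=> FX FY; have [XY|YX] := Ftot _ _ FX FY.
      by exists Y; split=> //; exact: subset_refl.
    by exists X; split=> //; exact: subset_refl.
  have domU X a : F X -> dom X a -> dom (\bigcup_(X in F) X) a.
    by move=> FX [c Xc]; exists c; exists X.
  split.
  - move=> a b c [X FX Xabc]; have [h _ _ _] := FP _ FX.
    by have [? ? ?] := h _ _ _ Xabc; split; exact: (domU X).
  - move=> a b [c [X FX Xc]] [c' [Y FY Yc']].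
    have [Z [FZ XZ YZ]] := common _ _ FX FY.
    have [_ h _ _] := FP _ FZ.
    have [||d Zd] := h a b; last by exists d; exists Z.
      by exists c; exact: XZ.
    by exists c'; exact: YZ.
  - move=> a b c c' [X FX Xc] [Y FY Yc].
    have [Z [FZ XZ YZ]] := common _ _ FX FY.
    have [_ _ h _] := FP _ FZ; exact: h (XZ _ Xc) (YZ _ Yc).
  - move=> a b a' b' c [X FX Xc] [Y FY Yc].
    have [Z [FZ XZ YZ]] := common _ _ FX FY.
    have [_ _ _ h] := FP _ FZ; exact: h (XZ _ Xc) (YZ _ Yc).
(* [Zorn_bigcup] also covers the empty chain, whose union is empty. Hence [S0] is adjoined to the
   members instead of being required as a subset. *)
have [|A [PA Amax]] := @Zorn_bigcup _ (fun S => P (S0 `|` S)).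
  move=> F FP Ftot.
  have -> : S0 `|` \bigcup_(X in F) X =
      \bigcup_(X in [set S0] `|` [set S0 `|` X | X in F]) X.
    apply/seteqP; split => x.
      move=> [S0x|[X FX Xx]]; first by exists S0 => //; left.
      by exists (S0 `|` X); [right; exists X|right].
    move=> [_ [->|[X FX <-]]]; first by left.
    by move=> [S0x|Xx]; [left|right; exists X].
  apply: Pchain.
    by move=> _ [->|[X FX <-]] //; exact: FP.
  move=> _ _ [->|[X FX <-]] [->|[Y FY <-]].
  - by left.
  - by left; move=> x; left.
  - by right; move=> x; left.
  - have [XY|YX] := Ftot _ _ FX FY; [left|right].
      by move=> x [?|/XY]; [left|right].
    by move=> x [?|/YX]; [left|right].
pose M := S0 `|` A; pose B := dom M.
have {Amax} Mmax M' : M `<=` M' -> P M' -> M' `<=` M.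
  move=> MM' PM'; apply: contrapT => nM.
  apply: (Amax M'); last first.
    suff -> : S0 `|` M' = M' by [].
    by apply/setUidPr => x S0x; apply: MM'; left.
  split; first by move=> x Ax; apply: MM'; right.
  by move=> M'A; apply: nM => x /M'A; right.
have [Mdom Mtot Mfun Minj] : P M by [].
have BS0 n : B (i0 n) by have [c Sc] := domS0 n; exists c; left.
have /choice[p0 p0M] : forall x : T * T, exists c, B x.1 -> B x.2 -> M (x.1, x.2, c).
  move=> [a b] /=; have [Ba|nB] := pselect (B a); last by exists a.
  have [Bb|nB] := pselect (B b); last by exists b.
  by have [c] := Mtot _ _ Ba Bb; exists c.
pose p a b := p0 (a, b).
have pM a b : B a -> B b -> M (a, b, p a b) by move=> Ba Bb; exact: (p0M (a, b)).
have pB a b : B a -> B b -> B (p a b).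
  by move=> Ba Bb; have [] := Mdom _ _ _ (pM _ _ Ba Bb).
have pI a b a' b' : B a -> B b -> B a' -> B b' -> p a b = p a' b' ->
    a = a' /\ b = b'.
  move=> Ba Bb Ba' Bb' e; have Mab := pM _ _ Ba Bb.
  rewrite e in Mab.
  by have [] := Minj _ _ _ _ _ Mab (pM _ _ Ba' Bb').
have i01 : i0 0 <> i0 1 by move=> /i0i.
have [[f [fB fi]]|[g [gB gi]]] := inj_on_total (~` B) B.
  (* The distinct tags [i0 0] and [i0 1] separate [B] from its complement, so all of [T] injects
     into [B], where [p] codes pairs. *)
  pose e t := if pselect (B t) then p (i0 0) t else p (i0 1) (f t).
  have eB t : B (e t) by rewrite /e; case: pselect => Bt; apply: pB => //; exact: fB.
  have eI t t' : e t = e t' -> t = t'.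
    rewrite /e; case: pselect => Bt; case: pselect => Bt' => /pI.
    - by case.
    - by case=> //; exact: fB.
    - by case=> //; [exact: fB|move=> /esym].
    - by case=> //; [exact: fB|exact: fB|move=> _ /fi]; apply.
  exists (fun x => p (e x.1) (e x.2)) => -[a b] [a' b'] /= /pI.
  by move=> [] // /eI -> /eI ->.
exfalso.
pose C := [set g x | x in B].
pose D := B `|` C.
have /choice[h hP] : forall x, exists y, C x -> B y /\ g y = x.
  move=> x; have [[y By <-]|nC] := pselect (C x); first by exists y.
  by exists x.
pose q x := if pselect (B x) then p (i0 0) x else p (i0 1) (h x).
have hB x : D x -> ~ B x -> B (h x) by move=> [//|/hP[]].
have qB x : D x -> B (q x).
  by move=> Dx; rewrite /q; case: pselect => Bx; apply: pB => //; exact: hB.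
have qI x y : D x -> D y -> q x = q y -> x = y.
  move=> Dx Dy; rewrite /q; case: pselect => Bx; case: pselect => By /pI [] //.
  - exact: hB.
  - exact: hB.
  - by move=> /esym.
  - exact: hB.
  - exact: hB.
  move=> _ exy; case: Dx => // /hP [_ <-]; case: Dy => // /hP [_ <-].
  by rewrite exy.
(* Pairs outside [B * B] get their values in [C], which is disjoint from [B] and hence from all old
   values. *)
pose M' := M `|` [set x | [/\ D x.1.1, D x.1.2, ~ (B x.1.1 /\ B x.1.2) &
   x.2 = g (p (q x.1.1) (q x.1.2))]].
have domM' : dom M' = D.
  apply/seteqP; split => x.
    by move=> [c [Mc|[//]]]; left; exists c.
  move=> Dx; have [Bx|nBx] := pselect (B x).
    by have [c Mc] := Bx; exists c; left.
  exists (g (p (q x) (q x))); right; split => //=.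
  by move=> [].
have gD a b : D a -> D b -> C (g (p (q a) (q b))).
  by move=> Da Db; exists (p (q a) (q b)) => //; apply: pB; exact: qB.
have CB x : C x -> ~ B x by move=> [y /gB ? <-].
have PM' : P M'.
  rewrite /P domM'; split.
  - move=> a b c [/Mdom[? ? ?]|[/= Da Db _ ->]]; first by split; left.
    by split=> //; right; exact: gD.
  - move=> a b Da Db; have [[Ba Bb]|nB] := pselect (B a /\ B b).
      by exists (p a b); left; exact: pM.
    by exists (g (p (q a) (q b))); right.
  - move=> a b c c' [Mc|[/= Da Db nB ->]] [Mc'|[/= Da' Db' nB' ->]] //.
    + exact: Mfun Mc Mc'.
    + by have [? ? _] := Mdom _ _ _ Mc; exfalso; apply: nB'.
    + by have [? ? _] := Mdom _ _ _ Mc'; exfalso; apply: nB.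
  - move=> a b a' b' c [Mc|[/= Da Db nB ->]] [Mc'|[/= Da' Db' nB' e]].
    + exact: Minj Mc Mc'.
    + have [_ _ Bc] := Mdom _ _ _ Mc; exfalso; apply: (CB c) => //.
      by rewrite e; exact: gD.
    + have [_ _ Bc] := Mdom _ _ _ Mc'; exfalso; apply: (CB _ _ Bc).
      exact: gD.
    + have eq4 : p (q a) (q b) = p (q a') (q b').
        by apply: gi e; apply: pB; exact: qB.
      have [ea eb] := pI _ _ _ _ (qB _ Da) (qB _ Db) (qB _ Da') (qB _ Db') eq4.
      by rewrite (qI _ _ Da Da' ea) (qI _ _ Db Db' eb).
have DB : D `<=` B.
  by rewrite -domM' => x [c /Mmax Mc]; exists c; apply: Mc => // ?; left.
have Cg : C (g (i0 0)) by exists (i0 0).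
by apply: (CB _ Cg); apply: DB; right.
Qed.

Lemma card_le_injects (A B : Type) :
  [set: A] #<= [set: B] -> injects A B.
Proof.
move=> /card_leP[f]; exists (fun a => \val (f (SigSub (mem_set (I : [set: A] a))))).
move=> a b /val_inj h.
have /(congr1 val) := 'inj_f (in_setT _) (in_setT _) h.
exact.
Qed.

(** * Cardinalities below the continuum *)

Definition small (T : Type) := ~ injects (nat -> bool) T.

Lemma small_injects (A B : Type) : injects A B -> small B -> small A.
Proof. by move=> AB sB cA; apply: sB; exact: injects_trans cA AB. Qed.

Lemma small_nat : small nat.
Proof.
move=> [f fi].
(* Cantor's diagonal: by injectivity [d] is the only sequence with code [f d], so its value there
   negates itself. *)
pose d n := ~~ `[< exists g : nat -> bool, f g = n /\ g n >].
have : d (f d) = ~~ d (f d).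
  rewrite {1}/d; congr (~~ _); apply/asboolP/idP => [[g [/fi ->]]//|dd].
  by exists d.
by case: (d (f d)).
Qed.

Lemma injects_countType (T : countType) : injects T nat.
Proof. by exists pickle; exact: pcan_inj pickleK. Qed.

(** Requirements indexed by finite data over a small type stay small: they all inject into [W]. A
    finite [T] is replaced by [nat], an infinite one absorbs its square. *)
Lemma small_hull (T : Type) : small T ->
  exists W : Type, [/\ small W, injects nat W, injects (W * W) W & injects T W].
Proof.
move=> sT; have [fT|/infiniteP/card_le_injects nT] :=
  pselect (finite_set [set: T]).
  exists nat; split; [exact: small_nat| |exact: injects_countType|].
    by exists id.
  have /countable_injP[f /in2TT fi] := finite_set_countable fT.
  by exists f.
by exists T; split=> //; [exact: injects_square|exists id].
Qed.

(** * Genericity from cov(M) *)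

Section binary_digits.
Variable R : realType.
Local Open Scope ring_scope.
Implicit Type x : R.

(** The index of the dyadic interval of length 1 / 2 ^ n that contains [x]; its parities for n > 0
    are the binary digits of the fractional part. *)
Definition dyadic x n : int := Num.floor (2 ^+ n * x).
Definition digits x n : seq bool :=
  mkseq (fun i => (dyadic x i.+1 %% 2)%Z == 1) n.

Lemma digitsS x n :
  digits x n.+1 = rcons (digits x n) ((dyadic x n.+1 %% 2)%Z == 1).
Proof. by rewrite /digits mkseqS. Qed.

Lemma dyadicS x n : dyadic x n = (dyadic x n.+1 %/ 2)%Z.
Proof.
apply: floor_def; rewrite /dyadic exprS -mulrA.
have /andP[] := floor_itv (2 * (2 ^+ n * x)).
set y := 2 ^+ n * x; set m := Num.floor _ => m1 m2.
have h1 : (m %/ 2)%Z * 2 <= m by lia.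
have h2 : m + 1 <= ((m %/ 2)%Z + 1) * 2 by lia.
move: h1 h2; rewrite -!(ler_int R) !rmorphM /= => h1 h2.
move: m1 m2 h1 h2; set a := _%:~R; set b := _%:~R; set c := _%:~R; set d := _%:~R.
by move=> *; apply/andP; split; lra.
Qed.

Lemma eq_digits x y n : dyadic x n = dyadic y n -> digits x n = digits y n.
Proof.
elim: n => [//|n IH] xy; rewrite !digitsS xy IH //.
by rewrite (dyadicS x n) (dyadicS y n) xy.
Qed.

(** Each digit [c] of [t] passes from the interval [b] to its half [2 * b + c]; [b'] is the
    subinterval reached in the end. *)
Lemma dyadic_extend n b t : exists b', forall x, dyadic x (n + size t)%N = b' ->
  dyadic x n = b /\ digits x (n + size t)%N = digits x n ++ t.
Proof.
elim: t n b => [|c t IH] n b /=.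
  by exists b => x; rewrite addn0 cats0.
have [b' b'P] := IH n.+1 (2 * b + c%:R); exists b' => x.
rewrite addnS -addSn => /b'P[e ->].
have := dyadicS x n; rewrite e => nE; split.
  by rewrite nE; case: c {b'P e nE} => /=; lia.
rewrite digitsS cat_rcons e; congr (_ ++ _ :: _).
by case: c {b'P e nE} => /=; lia.
Qed.

(** Every ball around [x] contains a dyadic interval around [x]. Continuing its digits into [D]
    gives a subinterval that misses the set, so the midpoint [y] of the subinterval is not in the
    closure. *)
Lemma nowhere_dense_digits (D : set (seq bool)) :
  (forall s, exists t, D (s ++ t)) ->
  nowhere_dense [set x : R | forall n, ~ D (digits x n)].
Proof.
move=> Ddense; set A := [set x | _]; apply/seteqP; split=> // x.
move=> /nbhs_ballP[e /= e0 xe].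
have [n en] : exists n, e^-1 < 2 ^+ n.
  have [n en] : exists n : nat, e^-1 < n%:R.
    by exists (Num.bound e^-1); rewrite archi_boundP// invr_ge0 ltW.
  exists n; apply: lt_trans en _; rewrite -natrX ltr_nat; exact: ltn_expl.
have n0 : 0 < 2 ^+ n :> R by rewrite exprn_gt0.
have [t Dt] := Ddense (digits x n).
have [b bP] := dyadic_extend n (dyadic x n) t.
pose N := (n + size t)%N; have N0 : 0 < 2 ^+ N :> R by rewrite exprn_gt0.
pose y : R := (b%:~R + 2^-1) / 2 ^+ N.
have Ny : 2 ^+ N * y = b%:~R + 2^-1 by rewrite mulrC divfK// gt_eqF.
have near_y z : `|y - z| < 2^-1 / 2 ^+ N -> dyadic z N = b.
  rewrite ltr_pdivlMr// -{1}(gtr0_norm N0) -normrM mulrC mulrBr Ny.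
  by rewrite ltr_norml => /andP[? ?]; apply: floor_def; rewrite intrD; lra.
have yb : dyadic y N = b.
  by apply: near_y; rewrite subrr normr0 divr_gt0// invr_gt0.
have [yx _] := bP _ yb.
have : closure A y.
  apply: xe; rewrite /ball /= -(ltr_pM2l n0) -{1}(gtr0_norm n0) -normrM mulrBr.
  apply: (@lt_trans _ _ 1); last by rewrite -ltr_pdivrMr// mul1r.
  move: yx; rewrite /dyadic => yx.
  have := floor_itv (2 ^+ n * x); have := floor_itv (2 ^+ n * y).
  by rewrite yx intrD ltr_norml; lra.
move=> /(_ (ball y (2^-1 / 2 ^+ N))) [|z [Az yz]].
  by apply: nbhsx_ballx; rewrite divr_gt0// invr_gt0.
have [zx zt] := bP _ (near_y _ yz).
by apply: (Az N); rewrite zt (eq_digits zx).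
Qed.

End binary_digits.

(** Otherwise the nowhere dense sets of reals whose digits avoid some [D j] would cover the line,
    and cov(M) = c would embed the continuum into [J]. *)
Lemma generic_digits (R : realType) (J : Type) (D : J -> set (seq bool)) :
  cov_meager_eq_continuum R -> small J ->
  (forall j s, exists t, D j (s ++ t)) ->
  exists x : R, forall j, exists n, D j (digits x n).
Proof.
move=> [_ cov] sJ Ddense; apply: contrapT => nx; apply: sJ.
pose M j := [set x : R | forall n, ~ D j (digits x n)].
apply: card_le_injects.
apply: card_le_trans (card_image_le M setT); apply: cov; split.
  move=> _ [j _ <-]; exists (fun=> M j); first by move=> _; exact: nowhere_dense_digits.
  by move=> x Mx; exists 0%N.
apply/seteqP; split=> // x _; move/forallNP: nx => /(_ x)/existsNP[j nj].
by exists (M j); [exists j|move=> n Dn; apply: nj; exists n].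
Qed.

(* A word over bool is read as a list of unary codes of conditions; each decoded
   condition replaces the current one whenever it extends it. *)
Lemma generic_filter (R : realType) (P : countType) (le : P -> P -> Prop)
    (p0 : P) (J : Type) (D : J -> set P) :
  (forall p, le p p) -> (forall p q r, le p q -> le q r -> le p r) ->
  cov_meager_eq_continuum R -> small J ->
  (forall j p, exists2 q, le q p & D j q) ->
  exists p : nat -> P, (forall m n, (m <= n)%N -> le (p n) (p m)) /\
    forall j, exists n, D j (p n).
Proof.
move=> lexx le_trans cov sJ Ddense.
(* The state is the current condition with the number of [true] read since the last [false]; a
   [false] ends the code. *)
pose step (st : P * nat) (b : bool) := if b then (st.1, st.2.+1) else
  (if unpickle st.2 is Some q then if `[< le q st.1 >] then q else st.1
   else st.1, 0%N).
pose run := foldl step (p0, 0%N).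
have step_le st b : le (step st b).1 st.1.
  rewrite /step; case: b => //=; case: unpickle => //= q.
  by case: asboolP.
have run_le s t : le (run (s ++ t)).1 (run s).1.
  rewrite /run foldl_cat; move: (foldl _ _ s) => st.
  elim: t st => [//|b t IH] st /=; exact: le_trans (IH _) (step_le _ _).
have [|x xP] := @generic_digits R J (fun j => [set s | D j (run s).1]) cov sJ.
  (* An initial [false] ends any unfinished code and may itself change the condition, so [q] is
     chosen below the condition reached after it. *)
  move=> j s; pose p := (run (rcons s false)).1.
  have [q qp Dq] := Ddense j p.
  exists (false :: rcons (nseq (pickle q) true) false) => /=.
  suff -> : run (s ++ false :: rcons (nseq (pickle q) true) false) = (q, 0%N) by [].
  have run_true k st : foldl step st (nseq k true) = (st.1, (st.2 + k)%N).
    elim: k st => [|k IH] [a c] /=; first by rewrite addn0.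
    by rewrite IH /= addSnnS.
  rewrite -cat_rcons /run foldl_cat foldl_rcons run_true [step _ false]/step /=.
  have -> : (foldl step (p0, 0%N) (rcons s false)).2 = 0%N.
    by rewrite -cats1 foldl_cat.
  by rewrite add0n pickleK; case: asboolP.
exists (fun n => (run (digits x n)).1); split=> // m n mn.
have -> : digits x n = digits x m ++ drop m (digits x n).
  rewrite -{1}(cat_take_drop m (digits x n)); congr (_ ++ _).
  by rewrite /digits -map_take take_iota (minn_idPl mn).
exact: run_le.
Qed.

(** * Generic sequences of integers *)

Local Open Scope ring_scope.

(* The matching sequence [a] is generic for finite sequences of approximations. *)
Lemma small_family_matched (R : realType) (J : Type) (y : J -> nat -> int)
    (m : nat -> nat) :
  cov_meager_eq_continuum R -> small J ->
  exists a : nat -> seq int, forall j, exists n, forall i, (i < m n)%N ->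
    (a n)`_i = y j i.
Proof.
move=> cov sJ.
have [||j p|p [p_le pP]] := @generic_filter R (seq (seq int))
  (fun q p => prefix p q) [::] J (fun j => [set p | exists2 n, (n < size p)%N &
     forall i, (i < m n)%N -> (nth [::] p n)`_i = y j i]) _ _ cov sJ.
- exact: prefix_refl.
- by move=> p q r qp rq; exact: prefix_trans rq qp.
(* The entry appended at position [size p] copies [y j] as far as that position demands. *)
- exists (rcons p (mkseq (y j) (m (size p)))); first exact: prefix_rcons.
  exists (size p); rewrite ?size_rcons// => i im.
  by rewrite nth_rcons ltnn eqxx nth_mkseq.
have coherent n k l : (n < size (p k))%N -> (n < size (p l))%N ->
    nth [::] (p k) n = nth [::] (p l) n.
  wlog kl : k l / (k <= l)%N.
    by move=> H nk nl; have [/H|/ltnW/H] := leqP k l; [exact|move=> ->].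
  move=> nk _; have /prefixP[s ->] := p_le _ _ kl.
  by rewrite nth_cat nk.
have /choice[a aP] : forall n, exists v, forall k, (n < size (p k))%N ->
    nth [::] (p k) n = v.
  move=> n; have [[k nk]|nex] := pselect (exists k, (n < size (p k))%N).
    by exists (nth [::] (p k) n) => l nl; exact: coherent.
  by exists [::] => k nk; exfalso; apply: nex; exists k.
exists a => j; have [k [n nk nP]] := pP j.
by exists n => i im; rewrite -(aP n k nk) nP.
Qed.

(** * Finite conditions with divisibility promises, and the dense requirements *)

Definition eventually_divisible (x : nat -> int) :=
  forall K, exists l, forall j, (l <= j)%N -> (K.+1%:Z %| x j)%Z.

(* The condition (s, K) describes the x : nat -> int that begin with s and all
   of whose later values are divisible by K + 1. *)
Definition condition : Type := (seq int * nat)%type.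

Section conditions.
Implicit Types (p q r : condition) (x : nat -> int).

(** The last clause bites only inside [q.1]: beyond its end the default 0 is divisible by
    everything. *)
Definition stronger q p :=
  [/\ (size p.1 <= size q.1)%N,
    forall j, (j < size p.1)%N -> q.1`_j = p.1`_j, (p.2.+1 %| q.2.+1)%N &
    forall j, (size p.1 <= j)%N -> (p.2.+1%:Z %| q.1`_j)%Z].
Definition begins_with x p := forall j, (j < size p.1)%N -> x j = p.1`_j.
Definition dense_property (Phi : set (nat -> int)) :=
  forall p, exists2 q, stronger q p & forall x, begins_with x q -> Phi x.

Lemma stronger_refl p : stronger p p.
Proof. by split=> // j pj; rewrite nth_default// dvdz0. Qed.

Lemma stronger_trans p q r : stronger p q -> stronger q r -> stronger p r.
Proof.
move=> [qp pq dp Kp] [rq qr dq Kq]; split.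
- exact: leq_trans rq qp.
- by move=> j jr; rewrite pq ?qr//; exact: leq_trans jr rq.
- exact: dvdn_trans dq dp.
- move=> j rj; have [jq|qj] := ltnP j (size q.1); first by rewrite pq ?Kq.
  exact: dvdz_trans (Kp _ qj).
Qed.

Definition extend p (v : nat -> int) n : condition :=
  (mkseq (fun j => if (j < size p.1)%N then p.1`_j else v j) n, p.2).

Lemma extend_stronger p v n : (size p.1 <= n)%N ->
  (forall j, (size p.1 <= j)%N -> (p.2.+1%:Z %| v j)%Z) ->
  stronger (extend p v n) p.
Proof.
move=> pn pv; split => //=; first by rewrite size_mkseq.
  by move=> j jp; rewrite nth_mkseq ?jp//; exact: leq_trans jp pn.
move=> j pj; have [jn|nj] := ltnP j n.
  by rewrite nth_mkseq// ltnNge pj /= pv.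
by rewrite nth_default ?dvdz0// size_mkseq.
Qed.

Lemma begins_with_extend x p v n : begins_with x (extend p v n) ->
  forall j, (j < n)%N -> x j = if (j < size p.1)%N then p.1`_j else v j.
Proof. by move=> xp j jn; rewrite xp ?size_mkseq//= nth_mkseq. Qed.

Lemma generic_point (R : realType) (J : Type) (Phi : J -> set (nat -> int)) :
  cov_meager_eq_continuum R -> small J -> (forall j, dense_property (Phi j)) ->
  exists x, eventually_divisible x /\ forall j, Phi j x.
Proof.
move=> cov sJ Phi_dense.
have sJN : small (J + nat).
  have [W [sW nW WW JW]] := small_hull sJ.
  by apply: small_injects sW; exact: injects_sum.
(* The added requirements [inr K] make the sequence total and its promises divisible by every
   positive integer. *)
pose D (i : J + nat) := match i with
  | inl j => [set p : condition | forall x, begins_with x p -> Phi j x]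
  | inr K => [set p : condition | (K < size p.1)%N /\ (K.+1 %| p.2.+1)%N]
  end.
have [[j p|K p]|p [p_le pP]] := generic_filter ([::], 0%N) stronger_refl
    stronger_trans cov sJN (D := D).
- exact: Phi_dense.
(* Promises are stored as predecessors; this one stands for the product of the old promise and
   [K.+1]. *)
- have KE : (p.2 * K.+1 + K).+1 = (p.2.+1 * K.+1)%N by lia.
  exists ((extend p (fun=> 0) (maxn (size p.1) K.+1)).1, p.2 * K.+1 + K)%N.
    have [||a b c d] := @extend_stronger p (fun=> 0) (maxn (size p.1) K.+1).
    + exact: leq_maxl.
    + by move=> j _; exact: dvdz0.
    + by split=> //; rewrite KE dvdn_mulr.
  by split; [rewrite size_mkseq leq_maxr|rewrite KE dvdn_mull].
have /choice[k kP] := fun K => pP (inr K).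
pose x j := (p (k j)).1`_j.
have xE n j : (j < size (p n).1)%N -> x j = (p n).1`_j.
  move=> jn; rewrite /x; have [kj _] := kP j.
  have [nk|/ltnW kn] := leqP n (k j).
    by have [_ -> //] := p_le _ _ nk.
  by have [_ -> //] := p_le _ _ kn.
exists x; split.
  move=> K; exists (size (p (k K)).1) => j Kj; have [_ dK] := kP K.
  have [kj _] := kP j.
  have [nk|/ltnW kn] := leqP (k K) (k j).
    have [_ _ _ /(_ j Kj)] := p_le _ _ nk.
    exact: dvdz_trans.
  (* This case is void: the sequence at stage [k j] is longer than [j], and the one at the later
     stage [k K] is not. *)
  have [s _ _ _] := p_le _ _ kn.
  by have := leq_trans kj (leq_trans s Kj); rewrite ltnn.
move=> j; have [n] := pP (inl j); apply => i ni; exact: xE.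
Qed.

(** That [x n] exceeds [m n] defeats Hurewicz-boundedness; that it dominates [b] and [x] below [m n]
    serves Scheepers-boundedness. *)
Definition peak (m b : nat -> nat) N x := exists n, [/\ (N <= n)%N,
  (n <= `|x n|)%N, (m n < `|x n|)%N &
  forall j, (j < m n)%N -> (b j <= `|x n|)%N /\ (`|x j| <= `|x n|)%N].

Lemma dense_peak (m b : nat -> nat) N : dense_property (peak m b N).
Proof.
move=> p; pose n := maxn N (size p.1).
(* The sum exceeds everything to be dominated. A multiple of it that keeps the promise is put at the
   undecided place [n], and zeros at the other new places. *)
pose M := (n + (m n).+1 + \sum_(j < m n) b j + \sum_(j < size p.1) `|(p.1`_j)%R|)%N.
pose v j : int := if j == n then (p.2.+1 * M)%:Z else 0.
exists (extend p v (maxn n.+1 (m n))).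
  apply: extend_stronger; first by rewrite leq_max; apply/orP; left; lia.
  by move=> j _; rewrite /v; case: eqP => _; [rewrite dvdzE/= dvdn_mulr|exact: dvdz0].
move=> x /begins_with_extend xE.
have xn : (M <= `|x n|)%N.
  rewrite xE ?leq_max ?ltnSn// ltnNge leq_maxr /= /v eqxx absz_nat.
  by rewrite leq_pmull.
exists n; split.
- exact: leq_maxl.
- by apply: leq_trans xn; rewrite /M; lia.
- by apply: leq_trans xn; rewrite /M; lia.
move=> j jm; split.
  apply: leq_trans xn; rewrite /M (bigD1 (Ordinal jm)) //=; lia.
rewrite {1}xE ?leq_max ?jm ?orbT//; case: ltnP => jp.
  by apply: leq_trans xn; rewrite /M (bigD1 (Ordinal jp) (F := fun j => `|_|%N)) //=; lia.
rewrite /v; case: eqP => [_|] //.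
rewrite xE ?leq_max ?ltnSn// ltnNge leq_maxr /= /v eqxx; exact: leqnn.
Qed.

Definition often_bounded (m h b : nat -> nat) := forall N, exists n,
  [/\ (N <= n)%N, (n <= h n)%N & forall j, (j < m n)%N -> (b j <= h n)%N].

(** For [n] beyond the sum of the entries of [p.1], the clause [n <= h n] makes [h n] absorb those
    entries; all further entries up to [m n] can be 0. *)
Lemma dense_bounded (m h b : nat -> nat) N : often_bounded m h b ->
  dense_property [set x | exists n, [/\ (N <= n)%N, (n <= h n)%N &
    forall j, (j < m n)%N -> (maxn `|x j| (b j) <= h n)%N]].
Proof.
move=> mhb p.
have [n [Nn nh bh]] := mhb (maxn N (\sum_(j < size p.1) `|(p.1`_j)%R|)%N).
exists (extend p (fun=> 0) (maxn (size p.1) (m n))).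
  by apply: extend_stronger => [|j _]; [exact: leq_maxl|exact: dvdz0].
move=> x /begins_with_extend xE; exists n; split=> //.
  by apply: leq_trans Nn; exact: leq_maxl.
move=> j jm; rewrite geq_max bh// andbT xE ?leq_max ?jm ?orbT//.
case: ltnP => // jp; move: Nn nh.
by rewrite (bigD1 (Ordinal jp)) //=; lia.
Qed.

Definition finseq n : seq int := odflt [::] (unpickle n).

Definition matched (m : nat -> nat) (g : nat -> int) :=
  exists n, forall j, (j < m n)%N -> (finseq n)`_j = g j.

(* Beyond a point past which k (K + 1) divides g one puts x = - g / k. *)
Lemma dense_matched m (k : int) g : k != 0 -> eventually_divisible g ->
  dense_property [set x | matched m (fun j => k * x j + g j)].
Proof.
move=> k0 gdiv [s K].
have [l lP] := gdiv (`|k| * K.+1).-1.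
have {}lP j : (l <= j)%N -> exists c, g j = k * (K.+1%:Z * c).
  move=> /lP; rewrite prednK ?muln_gt0 ?absz_gt0 ?k0// => /dvdzP[c ->].
  by exists (sgz k * c); rewrite PoszM abszEsg; ring.
pose w := maxn l (size s).
(* The sequence [t] records the values of [k * x + g] below [w], and its code [n] is fixed before
   [x] is prescribed up to [m n]. From [w] on, both [k * x + g] and the default of [t] are 0. *)
pose v j : int := if (j < l)%N then 0 else - (g j %/ k)%Z.
pose t := mkseq (fun j => k * (if (j < size s)%N then s`_j else v j) + g j) w.
pose n := pickle t.
have nE : finseq n = t by rewrite /finseq pickleK.
exists (extend (s, K) v (maxn w (m n))).
  apply: extend_stronger => [|j sj]; first by rewrite !leq_max leqnn orbT.
  rewrite /v; case: ltnP => [_|/lP[c ->]]; first exact: dvdz0.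
  by rewrite mulKz// -mulrN dvdz_mulr.
move=> x /begins_with_extend /= xE; exists n => j jm.
rewrite nE xE ?leq_max ?jm ?orbT//.
have [jw|wj] := ltnP j w; first by rewrite nth_mkseq.
rewrite nth_default ?size_mkseq//.
move: wj; rewrite geq_max => /andP[lj sj].
rewrite ltnNge sj /= /v ltnNge lj /=.
have [c ->] := lP _ lj; rewrite mulKz//; ring.
Qed.

End conditions.

Definition max_abs (T : Type) (y : T -> nat -> int) (L : seq T) (j : nat) : nat :=
  \max_(t <- L) `|y t j|%N.

Definition combination (T : Type) (y : T -> nat -> int) (d : seq int)
    (l : seq (int * T)) (j : nat) : int :=
  d`_j + \sum_(c <- l) c.1 * y c.2 j.

Lemma eventually_divisible_combination (T : Type) (y : T -> nat -> int) d l :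
  (forall t, eventually_divisible (y t)) ->
  eventually_divisible (combination y d l).
Proof.
move=> ydiv K; suff [n nP] : exists n, forall j, (n <= j)%N ->
    (K.+1%:Z %| \sum_(c <- l) c.1 * y c.2 j)%Z.
  exists (maxn n (size d)) => j; rewrite geq_max => /andP[nj dj].
  by rewrite /combination nth_default// add0r nP.
elim: l => [|c l [n nP]]; first by exists 0%N => j _; rewrite big_nil dvdz0.
have [n' n'P] := ydiv c.2 K.
exists (maxn n n') => j; rewrite geq_max => /andP[nj nj'].
by rewrite big_cons rpredD ?nP// dvdz_mull// n'P.
Qed.

(** One step of the recursion, with [T] the set of earlier indices. The requirements are indexed by
    finite data over [T]; in the last one, [None] stands for the new bound [m0] and [Some t] for an
    earlier one. *)
Lemma generic_extension (R : realType) (T : Type) (y : T -> nat -> int)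
    (m : T -> nat -> nat) (m0 : nat -> nat) :
  cov_meager_eq_continuum R -> small T ->
  (forall t, eventually_divisible (y t)) ->
  exists x, [/\ eventually_divisible x,
    forall L N, peak m0 (max_abs y L) N x,
    forall t L, often_bounded (m t) (fun n => `|y t n|%N) (max_abs y L) ->
      often_bounded (m t) (fun n => `|y t n|%N)
        (fun j => maxn `|x j| (max_abs y L j)) &
    forall o k d l, k != 0 ->
      matched (oapp m m0 o) (fun j => k * x j + combination y d l j)].
Proof.
move=> cov sT ydiv.
pose J := (seq T * nat + (T * seq T * nat +
  option T * int * seq int * seq (int * T)))%type.
have sJ : small J.
  have [W [sW nW WW TW]] := small_hull sT.
  have prodW A B : injects A W -> injects B W -> injects (A * B) W.
    by move=> AW BW; exact: injects_trans (injects_prod AW BW) WW.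
  have seqW A : injects A W -> injects (seq A) W by exact: injects_seq.
  have sumW A B : injects A W -> injects B W -> injects (A + B) W.
    exact: injects_sum.
  have countW (A : countType) : injects A W.
    exact: injects_trans (injects_countType A) nW.
  have optW : injects (option T) W.
    have : injects (T + unit) W by apply: sumW => //; exact: (countW unit).
    apply: injects_trans; exists (fun o => if o is Some t then inl t else inr tt).
    by move=> [a|] [b|] // [->].
  apply: small_injects sW; rewrite /J.
  by repeat first [exact: TW | exact: optW | exact: (countW nat) |
    exact: (countW int) | apply: (sumW) | apply: (prodW) | apply: (seqW)].
pose Phi (i : J) : set (nat -> int) := match i with
  | inl (L, N) => peak m0 (max_abs y L) N
  | inr (inl (t, L, N)) => [set x |
     often_bounded (m t) (fun n => `|y t n|%N) (max_abs y L) ->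
     exists n, [/\ (N <= n)%N, (n <= `|y t n|)%N & forall j, (j < m t n)%N ->
       (maxn `|x j| (max_abs y L j) <= `|y t n|)%N]]
  | inr (inr (o, k, d, l)) => [set x | k != 0 ->
     matched (oapp m m0 o) (fun j => k * x j + combination y d l j)]
  end.
have dense_imp (P : Prop) (F : set (nat -> int)) :
    (P -> dense_property F) -> dense_property [set x | P -> F x].
  move=> PF; have [/[dup] HP /PF FD p|nP p] := pselect P; last first.
    by exists p; [exact: stronger_refl|move=> x _ /nP].
  by have [q qp qF] := FD p; exists q => // x xq _; exact: qF.
have [i|x [xdiv xPhi]] := @generic_point R J Phi cov sJ.
  case: i => [[L N]|[[[t L] N]|[[[c k] d] l]]].
  - exact: dense_peak.
  - by apply: dense_imp => ?; exact: dense_bounded.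
  - apply: dense_imp => k0; apply: dense_matched => //.
    exact: eventually_divisible_combination.
exists x; split=> //.
- by move=> L N; exact: (xPhi (inl (L, N))).
- by move=> t L yL N; exact: (xPhi (inr (inl (t, L, N)))).
- by move=> o k d l; exact: (xPhi (inr (inr (o, k, d, l)))).
Qed.

(** * Recursion along a well-order with small initial segments *)

Lemma wf_dependent_choice (I X : Type) (lt : I -> I -> Prop)
    (Q : forall a, ({b | lt b a} -> X) -> X -> Prop) :
  well_founded lt -> (forall a y, exists x, Q a y x) ->
  exists f : I -> X, forall a, Q a (fun b => f (sval b)) (f a).
Proof.
move=> wf Qex; pose F a y : X := sval (cid (Qex a y)).
pose step a (rec : forall b, lt b a -> X) := F a (fun b => rec (sval b) (svalP b)).
exists (Fix wf (fun=> X) step) => a; rewrite [X in Q a _ X]Fix_eq.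
  exact: svalP (cid _).
move=> {}a f g fg; rewrite /step; congr (F a _).
by apply/funext => b; exact: fg.
Qed.

Record wo_index := WoIndex {
  wo_sort :> eqType;
  wo_lt : wo_sort -> wo_sort -> Prop;
  wo_wf : well_founded wo_lt;
  wo_trans : forall a b c, wo_lt a b -> wo_lt b c -> wo_lt a c;
  wo_total : forall a b, [\/ wo_lt a b, a = b | wo_lt b a];
  wo_small : forall a, small {b | wo_lt b a}
}.

Lemma continuum_wo_index : exists I : wo_index,
  exists m : I -> nat -> nat, forall f, exists a, m a = f.
Proof.
pose T : eqType := nat -> bool.
have [le le_wo] := well_ordering_principle T.
have le_refl a : le a a.
  have [|z [[/eqP za zP] _]] := le_wo (pred1 a); first by exists a; rewrite inE.
  by rewrite -{1}za zP// inE.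
have le_anti a b : le a b -> le b a -> a = b.
  (* Both [a] and [b] are least in the pair, and least elements are unique. *)
  move=> ab ba; have [|z [_ zP]] := le_wo (pred2 a b).
    by exists a; rewrite inE eqxx.
  transitivity z; [apply/esym|]; apply: zP; split; rewrite ?inE ?eqxx ?orbT//.
    by move=> c; rewrite inE => /orP[/eqP ->|/eqP ->].
  by move=> c; rewrite inE => /orP[/eqP ->|/eqP ->].
have le_min (A : set T) : A !=set0 -> exists2 z, A z & forall x, A x -> le z x.
  move=> [a Aa]; have [|z [[Az zA] _]] := le_wo [pred x | x \in A].
    by exists a; rewrite unfold_in; exact: mem_set.
  exists z; first by rewrite unfold_in in Az; exact: set_mem.
  by move=> x Ax; apply: zA; rewrite unfold_in; exact: mem_set.
pose lt a b := le a b /\ a <> b.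
have lt_min (A : set T) : A !=set0 -> exists2 z, A z & forall x, A x -> ~ lt x z.
  move=> /le_min[z Az zA]; exists z => // x /zA zx [xz]; apply.
  by apply: le_anti => //; rewrite xz zx.
have lt_total a b : [\/ lt a b, a = b | lt b a].
  have [->|/eqP ab] := eqVneq a b; first by constructor 2.
  have [|z [->|->] zP] := le_min [set a; b]; first by exists a; left.
    by constructor 1; split=> //; apply: zP; right.
  by constructor 3; split; [apply: zP; left|move=> /esym].
have lt_asym a b : lt a b -> ~ lt b a.
  move=> [ab nab] [ba _]; apply: nab; apply: le_anti => //; by rewrite ab ba.
have lt_trans a b c : lt a b -> lt b c -> lt a c.
  move=> ab bc.
  have [|z [[->|->]|->] zP] := lt_min [set a; b; c]; first by exists a; left; left.
  - have [//|ac|/zP] := lt_total a c; last by move=> /(_ (or_intror erefl)).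
    by move: ab; rewrite ac => /lt_asym.
  - by have /zP := ab => /(_ (or_introl (or_introl erefl))).
  - by have /zP := bc => /(_ (or_introl (or_intror erefl))).
have lt_wf : well_founded lt.
  move=> a; apply: contrapT => na.
  have [|z nz zP] := lt_min [set a | ~ Acc lt a]; first by exists a.
  apply: nz; constructor => b bz; apply: contrapT => nb; exact: zP nb bz.
pose good a := small {b | lt b a}.
pose I := {a : T | `[< good a >]}.
(* If some initial segment is not small, the one below the least such point [z] still has the size
   of the continuum and consists of good points. *)
have [e ei] : injects T I.
  have [allg|/existsNP] := pselect (forall a, good a).
    by exists (fun a => exist _ a (asboolT (allg a))) => a b [].
  move=> /lt_min[z /contrapT zc zmin].
  apply: injects_trans zc _.
  have zg (b : {b | lt b z}) : good (sval b).
    by apply: contrapT => /zmin; apply; exact: (svalP b).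
  exists (fun b => exist _ (sval b) (asboolT (zg b))) => -[a ?] [b ?] [ab].
  exact: eq_exist.
pose ltI (a b : I) := lt (sval a) (sval b).
have ltI_small a : small {b | ltI b a}.
  apply: small_injects (asboolW (svalP a)).
  exists (fun b : {b | ltI b a} =>
    exist (fun c => lt c (sval a)) (sval (sval b)) (svalP b)) => -[b ?] [c ?] [bc].
  by apply: eq_exist; exact: val_inj.
have ltI_total a b : [\/ ltI a b, a = b | ltI b a].
  have [ab|ab|ab] := lt_total (sval a) (sval b).
  - by constructor 1.
  - by constructor 2; apply: val_inj.
  - by constructor 3.
have ltI_wf : well_founded ltI.
  move=> a; have [u] : exists u, u = sval a by exists (sval a).
  elim: {u}(lt_wf u) a => u _ IH a uE; constructor => b ba.
  by apply: IH erefl; rewrite uE.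
exists (@WoIndex I ltI ltI_wf (fun a b c => @lt_trans _ _ _) ltI_total ltI_small) => /=.
pose h (f : nat -> nat) : I :=
  e (fun n => if unpickle n is Some (i, j) then f i == j else false).
have hi : injective h.
  move=> f g /ei fg; apply/funext => i.
  have := congr1 (fun u : nat -> bool => u (pickle (i, f i))) fg.
  by rewrite /= !pickleK eqxx => /esym/eqP.
exists (fun a => xget (fun=> 0%N) [set f | h f = a]) => f.
exists (h f); apply: hi; exact: (xgetPex _ (ex_intro [set g | h g = h f] f erefl)).
Qed.

(** * Generic families and their integer combinations *)

(** The first clause refutes Hurewicz-boundedness, the first two together give
    Scheepers-boundedness, and the third gives Rothberger-boundedness. *)
Definition generic_family (I : wo_index) (m : I -> nat -> nat)
    (x : I -> nat -> int) : Prop :=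
  [/\ forall a L N, (forall c, c \in L -> wo_lt c a) ->
      peak (m a) (max_abs x L) N (x a),
    forall a b L, wo_lt b a -> (forall c, c \in L -> wo_lt c a) ->
      often_bounded (m b) (fun n => `|x b n|%N) (max_abs x L) ->
      often_bounded (m b) (fun n => `|x b n|%N) (max_abs x (a :: L)) &
    forall a b k d l, b = a \/ wo_lt b a -> k != 0 ->
      (forall c, c \in l -> wo_lt c.2 a) ->
      matched (m b) (fun j => k * x a j + combination x d l j)].

Lemma map_preimage (A : eqType) (B : Type) (f : B -> A) (s : seq A) :
  (forall a, a \in s -> exists b, f b = a) -> exists t, s = map f t.
Proof.
elim: s => [|a s IH] sf; first by exists [::].
have [b <-] := sf a (mem_head _ _).
have [c cs|t ->] := IH; last by exists (b :: t).
by apply: sf; rewrite inE cs orbT.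
Qed.

(** Recursion by [generic_extension]. The values carry their proof of eventual divisibility, which
    later steps require of all predecessors; lists of smaller indices are lifted to the subtype of
    predecessors. *)
Lemma generic_family_exists (R : realType) (I : wo_index) (m : I -> nat -> nat) :
  cov_meager_eq_continuum R -> exists x, generic_family m x.
Proof.
move=> cov.
pose X := {x | eventually_divisible x}.
have [a y|x xP] := @wf_dependent_choice I X (@wo_lt I) (fun a y x =>
  let T := {b | wo_lt b a} in let v (t : T) := sval (y t) in
  let mT (t : T) := m (sval t) in
  [/\ forall L N, peak (m a) (max_abs v L) N (sval x),
    forall t L, often_bounded (mT t) (fun n => `|v t n|%N) (max_abs v L) ->
      often_bounded (mT t) (fun n => `|v t n|%N)
        (fun j => maxn `|sval x j| (max_abs v L j)) &
    forall o k d l, k != 0 ->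
      matched (oapp mT (m a) o) (fun j => k * sval x j + combination v d l j)])
  (@wo_wf I).
  have [|x [xdiv x1 x2 x3]] := generic_extension (y := fun t => sval (y t))
    (fun t => m (sval t)) (m a) cov (wo_small (a := a)).
    by move=> t; exact: (svalP (y t)).
  by exists (exist _ x xdiv).
have max_absE a (L : seq {b | wo_lt b a}) :
    max_abs (fun b => sval (x b)) (map sval L) =
    max_abs (fun b => sval (x (sval b))) L.
  by apply/funext => j; rewrite /max_abs big_map.
exists (fun a => sval (x a)); split.
- move=> a L N La; have [x1 _ _] := xP a.
  have [c /La ca|L' ->] := @map_preimage _ {b | wo_lt b a} sval L.
    by exists (exist _ c ca).
  by rewrite max_absE; exact: x1.
- move=> a b L ba La; have [_ x2 _] := xP a.
  have [c /La ca|L' ->] := @map_preimage _ {b | wo_lt b a} sval L.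
    by exists (exist _ c ca).
  rewrite max_absE => /(x2 (exist _ b ba)) /=.
  suff -> : (fun j => maxn `|sval (x a) j|
    (max_abs (fun b => sval (x (sval b))) L' j)) =
    max_abs (fun b => sval (x b)) (a :: map sval L') by [].
  by apply/funext => j; rewrite -max_absE /max_abs big_cons.
- move=> a b k d l ba k0 la; have [_ _ x3] := xP a.
  have [c /la ca|l' ->] := @map_preimage _ (int * {b | wo_lt b a})
      (fun c => (c.1, sval c.2)) l.
    by exists (c.1, exist _ c.2 ca); case: c ca.
  have -> : combination (fun b => sval (x b)) d
      [seq (c.1, sval c.2) | c <- l'] =
      combination (fun b => sval (x (sval b))) d l'.
    by apply/funext => j; rewrite /combination big_map.
  case: ba => [->|ba]; first exact: (x3 None).
  exact: (x3 (Some (exist _ b ba))).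
Qed.

Lemma wo_max (I : wo_index) (a0 : I) (L : seq I) :
  exists2 a, a \in a0 :: L & forall c, c \in a0 :: L -> c = a \/ wo_lt c a.
Proof.
elim: L a0 => [|b L IH] a0.
  by exists a0; rewrite ?inE// => c; rewrite inE => /eqP ->; left.
have [a aL aP] := IH b; have [a0a|a0a|aa0] := wo_total a0 a.
- exists a; first by rewrite inE aL orbT.
  by move=> c; rewrite inE => /predU1P[->|/aP//]; right.
- exists a; first by rewrite inE aL orbT.
  by move=> c; rewrite inE => /predU1P[->|/aP//]; left.
exists a0; first exact: mem_head.
move=> c; rewrite inE => /predU1P[->|/aP[->|ca]]; [by left|by right|right].
exact: wo_trans ca aa0.
Qed.

Lemma max_absP (T : eqType) (y : T -> nat -> int) L j (B : nat) :
  reflect (forall t, t \in L -> (`|y t j| <= B)%N) (max_abs y L j <= B)%N.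
Proof.
apply: (iffP (bigmax_leqP_seq _ _ _ _)) => h t tL; first exact: h.
by move=> _; exact: h.
Qed.

(** Induction on the length of [L], by the largest index [a] of [b :: L]. If [a] is [b], the peaks
    of [x b] dominate the rest; otherwise the second clause adds [x a] to the bound for the rest. *)
Lemma often_bounded_generic (I : wo_index) m x (b : I) L :
  generic_family m x ->
  often_bounded (m b) (fun n => `|x b n|%N) (max_abs x (b :: L)).
Proof.
move=> [xpeak xbdd _].
elim: {L}_.+1 {-2}L (ltnSn (size L)) => // s IH L Ls.
have [a aL aP] := wo_max b L.
have rest c : c \in [seq c <- L | c != a] -> wo_lt c a.
  rewrite mem_filter => /andP[/eqP ca cL].
  by have [|//|] := aP c; first by rewrite inE cL orbT.
have [ab|/eqP ab] := eqVneq a b.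
  subst a => N; have [n [Nn nx _ nP]] := xpeak _ _ N rest.
  exists n; split=> // j jm; have [Lj xj] := nP j jm.
  apply/max_absP => t; rewrite inE => /predU1P[->//|tL].
  have [->//|tb] := eqVneq t b.
  by move/max_absP: Lj; apply; rewrite mem_filter tb.
have ba : wo_lt b a.
  by have [/esym|] := aP b (mem_head _ _).
have {}aL : a \in L by move: aL; rewrite inE => /predU1P[].
have obL : often_bounded (m b) (fun n => `|x b n|%N)
    (max_abs x (b :: [seq c <- L | c != a])).
  apply: IH; rewrite size_filter; apply: leq_trans _ (Ls : (size L <= s)%N).
  rewrite -(count_predC (pred1 a) L) -add1n leq_add2r.
  by rewrite -has_count; apply/hasP; exists a => /=.
have {obL} := xbdd a b _ ba _ obL.
move=> H N; have [|n [Nn nx nP]] := H _ N.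
  by move=> c; rewrite inE => /predU1P[->|/rest].
exists n; split=> // j jm; move/max_absP: (nP j jm) => {}nP.
apply/max_absP => t tL; apply: nP; move: tL; rewrite !inE mem_filter.
by case: (t == a).
Qed.

Lemma combination_split (I : eqType) (x : I -> nat -> int) d l a j :
  combination x d l j = (\sum_(c <- l | c.2 == a) c.1) * x a j +
    combination x d [seq c <- l | c.2 != a] j.
Proof.
rewrite /combination addrCA; congr (_ + _).
rewrite (bigID (fun c => c.2 == a)) /= big_filter mulr_suml; congr (_ + _).
by apply: eq_bigr => c /eqP ->.
Qed.

(** The largest index is removed as long as its coefficients add up to zero and some index is not
    below [b]. *)
Lemma leading_term (I : wo_index) (x : I -> nat -> int) (b : I) d l :
  (exists2 l', (forall c, c \in l' -> wo_lt c.2 b) &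
     combination x d l = combination x d l') \/
  (exists a k l', [/\ b = a \/ wo_lt b a, k != 0,
     forall c, c \in l' -> wo_lt c.2 a &
     combination x d l = fun j => k * x a j + combination x d l' j]).
Proof.
elim: {l}_.+1 {-2}l (ltnSn (size l)) => // s IH l ls.
have [lb|/existsNP[c0 /not_implyP[c0l c0b]]] :=
  pselect (forall c, c \in l -> wo_lt c.2 b); first by left; exists l.
have [a al aP] := wo_max c0.2 (map snd l).
have {}aP c : c \in l -> c.2 = a \/ wo_lt c.2 a.
  by move=> cl; apply: aP; rewrite inE (map_f snd cl) orbT.
have ba : b = a \/ wo_lt b a.
  have [|->|ab] := wo_total b a; [by right|by left|exfalso; apply: c0b].
  by have [->//|ca] := aP _ c0l; exact: wo_trans ca ab.
pose k := \sum_(c <- l | c.2 == a) c.1.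
pose l' := [seq c <- l | c.2 != a].
have [k0|k0] := eqVneq k 0; last first.
  right; exists a, k, l'; split=> //.
    by move=> c; rewrite mem_filter => /andP[/eqP ca /aP[]].
    by apply/funext => j; exact: combination_split.
have -> : combination x d l = combination x d l'.
  by apply/funext => j; rewrite (combination_split _ _ _ a) -/k k0 mul0r add0r.
apply: IH; rewrite size_filter; apply: leq_trans _ (ls : (size l <= s)%N).
rewrite -(count_predC (fun c => c.2 == a) l) -add1n leq_add2r.
rewrite -has_count; apply/hasP.
move: al; rewrite inE => /predU1P[->|/mapP[c cl ->]]; first by exists c0 => /=.
by exists c => /=.
Qed.

(* Even steps catch the combinations whose leading index is at least b,
   odd steps catch the others, of which there are few. *)
Lemma combinations_matched (R : realType) (I : wo_index) m x (M : nat -> nat) :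
  cov_meager_eq_continuum R -> @generic_family I m x ->
  (forall f, exists a, m a = f) ->
  exists A : nat -> seq int, forall d l, exists n, forall j, (j < M n)%N ->
    (A n)`_j = combination x d l j.
Proof.
move=> cov [_ _ xmatch] m_surj.
(* With this [b], [matched (m b)] compares with the finite sequence number n on as many coordinates
   as step 2n demands. *)
have [b mb] := m_surj (fun n => M n.*2).
pose T := {c | wo_lt c b}.
pose J := (seq int * seq (int * T))%type.
have sJ : small J.
  have [W [sW nW WW TW]] := small_hull (@wo_small I b).
  have intW : injects int W := injects_trans (injects_countType int) nW.
  apply: small_injects sW; apply: injects_trans (WW); apply: injects_prod.
    exact: injects_seq.
  by apply: injects_seq => //; apply: injects_trans (WW); exact: injects_prod.
have [a aP] := small_family_matched (fun j : J =>
  combination (fun c : T => x (sval c)) j.1 j.2) (fun n => M n.*2.+1) cov sJ.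
exists (fun n => if odd n then a n./2 else finseq n./2) => d l.
have [[l0 l0b ->]|[c [k [l' [bc k0 l'c ->]]]]] := leading_term x b d l.
  have [c /l0b cb|l' ->] := @map_preimage _ (int * {c | wo_lt c b})
      (fun c => (c.1, sval c.2)) l0.
    by exists (c.1, exist _ c.2 cb); case: c cb.
  have [n nP] := aP (d, l'); exists n.*2.+1 => j /nP.
  rewrite /= odd_double /= uphalf_double => ->.
  by rewrite /combination big_map.
have [n nP] := xmatch c b k d l' bc k0 l'c.
by exists n.*2 => j jM; rewrite odd_double doubleK nP// mb.
Qed.

Lemma combination_le (I : eqType) (x : I -> nat -> int) d l j (B : nat) :
  (forall c, c \in l -> (`|x c.2 j| <= B)%N) ->
  (`|combination x d l j| <=
    (\sum_(z <- d) `|z| + \sum_(c <- l) `|c.1|) * B.+1)%N.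
Proof.
move=> lB; rewrite mulnDl.
have abszD_le (z z' : int) : (`|(z + z')%R| <= `|z| + `|z'|)%N by lia.
apply: leq_trans (abszD_le _ _) _; apply: leq_add.
  (* The factor [B.+1] is positive, so the finite part [d] is bounded even when [B] is 0. *)
  apply: leq_trans (leq_pmulr _ _) => //.
  elim: d j {lB} => [|z d IH] [|j] //=; rewrite ?nth_nil// big_cons.
    exact: leq_addr.
  by apply: leq_trans (IH j) _; exact: leq_addl.
elim: l lB => [|c l IH] lB; first by rewrite !big_nil.
rewrite !big_cons mulnDl; apply: leq_trans (abszD_le _ _) _; apply: leq_add.
  by rewrite abszM leq_mul2l (leqW (lB _ (mem_head _ _))) orbT.
by apply: IH => c' c'l; apply: lB; rewrite inE c'l orbT.
Qed.

Lemma combinations_bounded (I : wo_index) m x (M : nat -> nat) :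
  @generic_family I m x -> (forall f, exists a, m a = f) ->
  exists h : nat -> nat, forall F : seq (seq int * seq (int * I)), exists n,
    forall f, f \in F -> forall j, (j < M n)%N ->
      (`|combination x f.1 f.2 j| <= h n)%N.
Proof.
move=> gx m_surj; have [b mb] := m_surj M.
(* For suitable n, the factor [n] bounds the sum of the coefficients of each member of [F], and
   [x b n] bounds all generators in use. *)
exists (fun n => n * `|x b n|.+1)%N => F.
pose w (f : seq int * seq (int * I)) :=
  (\sum_(z <- f.1) `|z| + \sum_(c <- f.2) `|c.1|)%N.
have [n [Nn _ nP]] := often_bounded_generic b
  (flatten [seq map snd f.2 | f <- F]) gx (\sum_(f <- F) w f)%N.
exists n => f fF j jM; rewrite -mb in jM; move/max_absP: (nP j jM) => {}nP.
apply: leq_trans (combination_le (B := `|x b n|) _ _) _.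
  move=> c cf; apply: nP; rewrite inE; apply/orP; right.
  by apply/flattenP; exists (map snd f.2); exact: map_f.
rewrite leq_mul2r; apply/orP; right; apply: leq_trans Nn.
by rewrite (big_rem _ fF) /=; exact: leq_addr.
Qed.

(** * The generated subgroup *)

(** The filter generated by the cylinders at [f] converges to [f] in each coordinate, hence in the
    product topology. *)
Lemma nbhs_ZN (f : ZN) (U : set ZN) : nbhs f U ->
  exists m, forall g : ZN, (forall j, (j < m)%N -> g j = f j) -> U g.
Proof.
pose F : set_system ZN := filter_from [set: nat]
  (fun m => [set g : ZN | forall j, (j < m)%N -> g j = f j]).
have FF : Filter F.
  apply: filter_from_filter; first by exists 0%N.
  move=> m n _ _; exists (maxn m n) => // g gP.
  by split=> j jm; apply: gP; rewrite leq_max jm ?orbT.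
suff Ff : F --> f by move=> /Ff [m _ mU]; exists m.
apply/(@cvg_sup (forall _ : nat, Zdiscrete) nat (fun i =>
  Topological.class (initial_topology (fun f : nat -> Zdiscrete => f i))) F f) => i V.
rewrite (@nbhsE (initial_topology (fun f : nat -> Zdiscrete => f i))).
move=> [B [[C _ CB] Bf] BV]; exists i.+1 => // g gf; apply: BV.
by move: Bf; rewrite -CB /= gf.
Qed.

Definition coordinate (G : zmodClosed ZN) (g : subgroup_type G) : nat -> int :=
  (subgroup_val g : ZN).

Section subgroup_neighborhoods.
Variable G : zmodClosed ZN.
Local Notation S := (subgroup_type G).

Lemma coordinateD (a b : S) j :
  coordinate (a + b) j = coordinate a j + coordinate b j.
Proof. by []. Qed.

Lemma coordinateB (a b : S) j :
  coordinate (a - b) j = coordinate a j - coordinate b j.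
Proof. by []. Qed.

Lemma nbhs_subgroup (U : set S) : nbhs (0 : S) U ->
  exists m, forall g, (forall j, (j < m)%N -> coordinate g j = 0) -> U g.
Proof.
rewrite (@nbhsE (initial_topology (@subgroup_val _ G))).
move=> [B [[C Cop CB] B0] BU].
have C0 : C (0 : ZN) by move: B0; rewrite -CB.
have [m mC] := nbhs_ZN (open_nbhs_nbhs (conj Cop C0)).
by exists m => g g0; apply: BU; rewrite -CB; apply: mC => j /g0.
Qed.

Lemma subgroup_nbhs m :
  nbhs (0 : S) [set g | forall j, (j < m)%N -> coordinate g j = 0].
Proof.
elim: m => [|m IH]; first by apply: filterS filterT.
have nm : nbhs (0 : S) [set g | coordinate g m = 0].
  have cm : continuous (fun g : S => coordinate g m : Zdiscrete).
    move=> g; apply: (@continuous_comp _ _ _ (@subgroup_val _ G)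
      (fun g : ZN => g m)); first exact: initial_continuous.
    exact: (@proj_continuous nat (fun=> Zdiscrete) m).
  by apply: (cm 0 [set 0]); exact: discrete_set1.
apply: filterS (filterI nm IH) => g [gm gj] j.
by rewrite ltnS leq_eqVlt => /predU1P[->//|/gj].
Qed.

End subgroup_neighborhoods.

(** * The group of integer combinations and its boundedness properties *)

Definition combinations (I : Type) (x : I -> nat -> int) : {pred ZN} :=
  [pred g : ZN | `[< exists d l, g = combination x d l :> (nat -> int) >]].

Lemma combinations_zmod_closed (I : Type) (x : I -> nat -> int) :
  zmod_closed (combinations x).
Proof.
split.
  apply/asboolP; exists [::], [::]; apply/funext => j.
  by rewrite /combination big_nil nth_nil.
move=> g h /asboolP[d [l gE]] /asboolP[e [k hE]]; apply/asboolP.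
exists (mkseq (fun j => d`_j - e`_j) (maxn (size d) (size e))).
exists (l ++ [seq (- c.1, c.2) | c <- k]); apply/funext => j.
have -> : (g - h) j = (g j : int) - h j by [].
rewrite gE hE /combination big_cat big_map /=.
under [X in _ = _ + (_ + X)]eq_bigr do rewrite mulNr.
rewrite sumrN; have [jn|nj] := ltnP j (maxn (size d) (size e)).
  by rewrite nth_mkseq//; ring.
rewrite (nth_default _ (s := mkseq _ _)) ?size_mkseq//.
move: nj; rewrite geq_max => /andP[dj ej].
by rewrite !nth_default//; ring.
Qed.

HB.instance Definition _ (I : Type) (x : I -> nat -> int) :=
  GRing.isZmodClosed.Build ZN (combinations x) (combinations_zmod_closed x).

Section combinations_group.
Variables (I : Type) (x : I -> nat -> int).
Let G : zmodClosed ZN := combinations x.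
Local Notation S := (subgroup_type G).

Lemma finseq_combination (s : seq int) :
  ((fun j => s`_j) : ZN) \in G.
Proof.
by apply/asboolP; exists s, [::]; apply/funext => j; rewrite /combination big_nil addr0.
Qed.

Definition finite_element (s : seq int) : S :=
  exist (fun g : ZN => g \in G) (fun j => s`_j) (finseq_combination s).

Lemma rothberger_combinations :
  (forall M : nat -> nat, exists A : nat -> seq int, forall d l, exists n,
    forall j, (j < M n)%N -> (A n)`_j = combination x d l j) ->
  rothberger_bounded S.
Proof.
move=> matching U U0.
have /choice[M MU] := fun n => nbhs_subgroup (U0 n).
have [A AP] := matching M.
exists (fun n => finite_element (A n)); apply/seteqP; split=> // g _.
have /asboolP[d [l gE]] := svalP g.
have [n nP] := AP d l; exists n => //; exists (g - finite_element (A n)).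
  apply: MU => j jM; rewrite coordinateB /coordinate /subgroup_val gE -nP//.
  exact: subrr.
by rewrite addrC subrK.
Qed.

Lemma scheepers_combinations :
  (forall M : nat -> nat, exists h : nat -> nat,
     forall (B : set (seq int * seq (int * I))), finite_set B -> exists n,
     forall f, B f -> forall j, (j < M n)%N ->
      (`|combination x f.1 f.2 j| <= h n)%N) ->
  scheepers_bounded S.
Proof.
move=> bounding U U0.
have /choice[M MU] := fun n => nbhs_subgroup (U0 n).
have [h hP] := bounding M.
(* All sequences of length [M n] with entries from [- h n] to [h n]; an entry is coded by its shift
   by [h n]. *)
pose code n (t : (M n).-tuple 'I_(h n).*2.+1) :=
  finite_element [seq (val i)%:Z - (h n)%:Z | i <- t].
exists (fun n => [set code n t | t in [set: (M n).-tuple 'I_(h n).*2.+1]]).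
  by move=> n; exact: finite_image.
have /choice[rep repP] : forall g : S, exists f,
    coordinate g = combination x f.1 f.2.
  by move=> g; have /asboolP[d [l gE]] := svalP g; exists (d, l).
move=> B finB; have [n nP] := hP _ (finite_image rep finB).
exists n => g Bg.
have gh j : (j < M n)%N -> (`|coordinate g j| <= h n)%N.
  by move=> jM; rewrite repP; apply: nP => //; exists g.
pose t := mktuple (fun i : 'I_(M n) =>
  inord (absz (coordinate g i + (h n)%:Z)) : 'I_(h n).*2.+1).
exists (code n t); first by exists t.
exists (g - code n t); last by rewrite addrC subrK.
apply: MU => j jM; rewrite coordinateB.
have -> : coordinate (code n t) j = [seq (val i)%:Z - (h n)%:Z | i <- t]`_j by [].
have gjh := gh j jM.
rewrite (nth_map (inord 0)); last by rewrite size_tuple.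
rewrite -(tnth_nth (inord 0) t (Ordinal jM)) tnth_mktuple [val _]inordK /=; lia.
Qed.

(** For the neighborhoods of elements vanishing up to coordinate n inclusive, a finite set [A n]
    bounds coordinate n of its whole translate by some [h n], which [x a] exceeds infinitely
    often. *)
Lemma not_hurewicz_combinations :
  (forall h : nat -> nat, exists a, forall N, exists2 n, (N <= n)%N &
     (h n < `|x a n|)%N) ->
  ~ hurewicz_bounded S.
Proof.
move=> unbounded /(_ (fun n => [set g | forall j, (j < n.+1)%N -> coordinate g j = 0])).
move=> [n|A finA AP]; first exact: subgroup_nbhs.
have /choice[h hP] : forall n, exists b : nat, forall g : S, A n g ->
    (`|coordinate g n| <= b)%N.
  move=> n; have /finite_seqP[s ->] := finA n.
  exists (\sum_(g <- s) `|coordinate g n|)%N => g gs.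
  by rewrite (big_rem _ gs) /=; exact: leq_addr.
have [a aP] := unbounded h.
have xaG : (x a : ZN) \in G.
  apply/asboolP; exists [::], [:: (1, a)]; apply/funext => j.
  by rewrite /combination big_seq1 nth_nil add0r mul1r.
have [N _ NP] := AP (exist (fun g : ZN => g \in G) (x a) xaG).
have [n Nn] := aP N; apply/negP; rewrite -leqNgt.
have [g Ag [u u0 gu]] := NP n Nn.
have := hP n g Ag.
have -> : x a n = coordinate g n; last by [].
have /(congr1 (fun g : S => coordinate g n)) := gu.
by rewrite coordinateD u0 // => /esym e; rewrite -[RHS]addr0; exact: e.
Qed.

End combinations_group.

Theorem theorem7p5 (R : realType) (hcov : cov_meager_eq_continuum R) :
  exists G : zmodClosed ZN,
    [/\ rothberger_bounded (subgroup_type G),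
        scheepers_bounded (subgroup_type G) &
        ~ hurewicz_bounded (subgroup_type G)].
Proof.
have [I [m m_surj]] := continuum_wo_index.
have [x gx] := generic_family_exists m hcov.
exists (combinations x : zmodClosed ZN); split.
- by apply: rothberger_combinations => M; exact: (combinations_matched M hcov gx m_surj).
- apply: scheepers_combinations => M.
  have [h hP] := combinations_bounded M gx m_surj; exists h.
  by move=> B /finite_seqP[F ->]; exact: hP.
(* Since [m a] is [h], the peaks of [x a], taken with an empty list of predecessors, exceed [h]
   arbitrarily far out. *)
- apply: not_hurewicz_combinations => h; have [a ma] := m_surj h.
  exists a => N; have [xpeak _ _] := gx.
  have [|n [Nn _ hn _]] := xpeak a [::] N; first by [].
  by exists n; rewrite -?ma.
Qed.
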